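(* For every fixed $k\ge 1$, the generating function $P_k(z)=\sum_{n\ge 1}p_{n,k}z^n$, where $p_{n,k}$ is the number of pop-stacked permutations of size $n$ with exactly $k$ runs, is a rational function of $z$.
   Context: Runs of a permutation are its maximal increasing strings of consecutive entries; falls are its maximal decreasing strings of consecutive entries. The flip $T$ reverses every fall of a permutation in place. A permutation $\tau$ is pop-stacked if $\tau=T(\pi)$ for some permutation $\pi$. *)

(* Defs.v *)
From HB Require Import structures.
From mathcomp Require Import all_boot all_order all_algebra all_fingroup.

Set Implicit Arguments.
Unset Strict Implicit.
Unset Printing Implicit Defensive.

Import GRing.Theory.

(* The factorization of s into maximal nonempty blocks of consecutive entries
   in which every entry is r-related to the next one; the lemmas below
   characterize it. *)
Fixpoint max_strings (r : rel nat) (s : seq nat) : seq (seq nat) :=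
  if s is x :: s' then
    match max_strings r s' with
    | (y :: t) :: u =>
        if r x y then (x :: y :: t) :: u else [:: x] :: (y :: t) :: u
    | _ => [:: [:: x]]
    end
  else [::].

Definition runs (s : seq nat) : seq (seq nat) := max_strings ltn s.

Definition falls (s : seq nat) : seq (seq nat) := max_strings gtn s.

Definition flip (s : seq nat) : seq nat := flatten [seq rev f | f <- falls s].

(* One-line notation, with values 0, ..., n - 1 instead of 1, ..., n. *)
Definition one_line (n : nat) (p : 'S_n) : seq nat :=
  [seq val (p i) | i <- enum 'I_n].

Definition pop_stacked (n : nat) (t : 'S_n) : bool :=
  [exists p : 'S_n, one_line t == flip (one_line p)].

Definition num_pop_stacked (n k : nat) : nat :=
  #|[set t : 'S_n | pop_stacked t & size (runs (one_line t)) == k]|.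

Local Open Scope ring_scope.

(* A formal power series over rat is its sequence of coefficients. *)
Definition fps := nat -> rat.

Definition fps_of_poly (p : {poly rat}) : fps := fun n => p`_n.

Definition fps_mul (f g : fps) : fps :=
  fun n => \sum_(i < n.+1) f i * g (n - i)%N.

(* f = a / b as formal power series; b`_0 != 0 says that b is invertible in
   the ring of formal power series. *)
Definition is_rational (f : fps) : Prop :=
  exists a b : {poly rat},
    b`_0 != 0 /\ fps_mul (fps_of_poly b) f =1 fps_of_poly a.

(* The sum starts at n = 1, so the constant coefficient is 0. *)
Definition pop_stacked_gf (k : nat) : fps :=
  fun n => if n is 0%N then 0 else (num_pop_stacked n k)%:R.

Section MaxStrings.

Variable r : rel nat.

Lemma max_strings_cons x s :
  exists t u, max_strings r (x :: s) = (x :: t) :: u.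
Proof.
rewrite /=; case: (max_strings r s) => [|[|y t] u]; try by exists [::], [::].
by case: ifP => _; [exists (y :: t), u | exists [::], ((y :: t) :: u)].
Qed.

Lemma flatten_max_strings s : flatten (max_strings r s) = s.
Proof.
elim: s => // x [|y s] IHs //; move: IHs.
have [t [u E]] := max_strings_cons y s.
by rewrite [max_strings r [:: x, y & s]]/= -/(max_strings r (y :: s)) E;
   case: ifP => _ /= [->].
Qed.

Lemma max_strings_neq0 s : [::] \notin max_strings r s.
Proof.
elim: s => // x [|y s] IHs //; move: IHs.
have [t [u E]] := max_strings_cons y s.
by rewrite [max_strings r [:: x, y & s]]/= -/(max_strings r (y :: s)) E;
   case: ifP => _; rewrite !inE.
Qed.

Lemma max_strings_sorted s : all (sorted r) (max_strings r s).
Proof.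
elim: s => // x [|y s] IHs //; move: IHs.
have [t [u E]] := max_strings_cons y s.
rewrite [max_strings r [:: x, y & s]]/= -/(max_strings r (y :: s)) E.
by case: ifP => /= rxy /andP[-> ->]; rewrite ?rxy.
Qed.

(* Maximality: two adjacent blocks cannot be merged. *)
Lemma max_strings_maximal s :
  sorted (fun b c => ~~ r (last 0%N b) (head 0%N c)) (max_strings r s).
Proof.
elim: s => // x [|y s] IHs //; move: IHs.
have [t [u E]] := max_strings_cons y s.
rewrite [max_strings r [:: x, y & s]]/= -/(max_strings r (y :: s)) E.
case: ifP => /= rxy; last by rewrite rxy.
by case: u {E}.
Qed.

End MaxStrings.

(* Main.v *)
(* The runs of a permutation t can be recovered from the word u sending each
   value v to the index of the run containing v. A permutation is pop-stacked
   iff any two adjacent runs b, c satisfy min b <= max c, and maximality of runs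
   says min c <= max b; in terms of u, each of i (i+1) and (i+1) i is a scattered
   subword of u. Hence pop-stacked permutations with k runs correspond to the
   words of a regular language over k letters, and counting these with the
   transfer matrix of an automaton gives, by the Cayley-Hamilton theorem, a
   linear recurrence with constant coefficients. *)

Require Import Defs.
From mathcomp Require Import all_boot all_order all_algebra all_fingroup.

Set Implicit Arguments.
Unset Strict Implicit.
Unset Printing Implicit Defensive.

Import GRing.Theory.

(** * Rationality from linear recurrences and finite automata *)

Section RationalSeries.

Local Open Scope ring_scope.

(* The denominator is the reciprocal of the characteristic polynomial of [A]. *)
Lemma is_rational_linear_rec (N : nat) (A : 'M[rat]_N.+1)
    (x : nat -> 'cV[rat]_N.+1) (i : 'I_N.+1) :
  (forall n, x n.+1 = A *m x n) -> is_rational (fun n => x n i 0).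
Proof.
move=> xS; set d := N.+1.
have xD n m : x (n + m)%N = A ^+ m *m x n.
  elim: m => [|m IHm]; first by rewrite addn0 expr0 mul1mx.
  by rewrite addnS xS IHm exprS mulmxA.
pose f n := x n i 0; pose b := \poly_(j < d.+1) (char_poly A)`_(d - j).
pose a := fps_mul (fps_of_poly b) f.
(* The numerator is the product of [b] and [f] cut off at degree [d], so it remains to show that the
   product vanishes from degree [d] on. The constant term of [b] is the leading coefficient of the
   monic [char_poly A]. *)
exists (\poly_(j < d) a j), b; split.
  rewrite coef_poly subn0.
  have /monicP := char_poly_monic A.
  by rewrite lead_coefE size_char_poly => ->; rewrite oner_neq0.
move=> m; rewrite -[LHS]/(a m) /fps_of_poly coef_poly.
case: ltnP => // le_dm.
rewrite /a /fps_mul /fps_of_poly.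
rewrite (bigID (fun j : 'I_m.+1 => (j < d.+1)%N)) /= addrC big1 ?add0r; last first.
  by move=> j /negPf lt_dj; rewrite coef_poly lt_dj mul0r.
rewrite -(big_ord_widen _ (fun j => b`_j * f (m - j)%N)) //.
rewrite (reindex_inj rev_ord_inj) /=.
(* After reversal the sum is the [i]-th entry of [char_poly A], evaluated at [A], times
   [x (m - d)]. *)
have /(congr1 (fun M => (M *m x (m - d)%N) i 0)) := Cayley_Hamilton A.
rewrite /= mul0mx [RHS]mxE => CH; apply: etrans CH.
rewrite /horner_mx /horner_morph /= horner_coef size_map_poly_id0; last first.
  have /monicP -> := char_poly_monic A.
  by rewrite -[_%:M]/1 oner_neq0.
rewrite size_char_poly mulmx_suml summxE; apply: eq_bigr => j _.
have le_jd : (j <= d)%N by rewrite -ltnS.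
rewrite coef_poly subSS ltnS leq_subr subKn // coef_map /=.
rewrite -mulmxE mul_scalar_mx -scalemxAl !mxE /f; congr (_ * _).
have -> : (m - (d - j) = m - d + j)%N by rewrite subnA // addnBAC.
by rewrite xD mxE.
Qed.

Lemma sum_tuple_cons (T : finType) (n : nat) (F : seq T -> nat) :
  (\sum_(w : n.+1.-tuple T) F w = \sum_a \sum_(w : n.-tuple T) F (a :: w))%N.
Proof.
rewrite pair_bigA /= (reindex (fun p : T * n.-tuple T => [tuple of p.1 :: p.2])) //.
exists (fun w : n.+1.-tuple T => (thead w, [tuple of behead w])) => [[a w]|w] _ /=.
  by congr pair; apply: val_inj.
by rewrite [RHS]tuple_eta.
Qed.

(** Transfer matrix method: splitting off the first letter gives a linear recurrence for the vector
    that lists, for each start state, the number of accepted words of length [n]. *)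
Lemma is_rational_automaton (T Q : finType) (d : Q -> T -> Q) (q0 : Q)
    (acc : pred Q) :
  is_rational (fun n => #|[set w : n.-tuple T | acc (foldl d q0 w)]|%:R).
Proof.
pose c n q := #|[set w : n.-tuple T | acc (foldl d q w)]|.
have cE n q : c n q = (\sum_(w : n.-tuple T) acc (foldl d q w))%N.
  by rewrite /c cardsE -sum1_card big_mkcond.
have cS n q : c n.+1 q = (\sum_a c n (d q a))%N.
  rewrite cE (sum_tuple_cons _ (fun w => acc (foldl d q w) : nat)).
  by apply: eq_bigr => a _; rewrite cE.
case E : #|Q| => [|N]; first by have := card0_eq E q0.
pose e i : Q := enum_val (cast_ord (esym E) i).
pose r q : 'I_N.+1 := cast_ord E (enum_rank q).
have rK : cancel r e by move=> q; rewrite /e /r cast_ordK enum_rankK.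
have eK : cancel e r by move=> j; rewrite /e /r enum_valK cast_ordKV.
(* The entry at [(i, j)] counts the letters leading from state [i] to state [j]. *)
pose A := \matrix_(i, j) (\sum_(a : T) (r (d (e i) a) == j)%:R) : 'M[rat]_N.+1.
pose x n := \col_i (c n (e i))%:R : 'cV[rat]_N.+1.
have xS n : x n.+1 = A *m x n.
  apply/colP => j; rewrite !mxE cS natr_sum.
  under [RHS]eq_bigr do rewrite !mxE big_distrl /=.
  rewrite exchange_big /=; apply: eq_bigr => a _.
  rewrite (bigD1 (r (d (e j) a))) //= eqxx mul1r rK big1 ?addr0 // => l.
  by rewrite eq_sym => /negPf->; rewrite mul0r.
have [a [b [b0 ab]]] := is_rational_linear_rec (r q0) xS.
exists a, b; split=> // n; rewrite -ab; apply: eq_bigr => l _.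
by rewrite !mxE rK.
Qed.

End RationalSeries.

(** * Uniqueness of the factorization into maximal strings *)

Lemma max_strings_cat (r : rel nat) b c cs t :
    b != [::] -> sorted r b -> max_strings r t = c :: cs ->
  max_strings r (b ++ t) =
    if r (last 0 b) (head 0 c) then (b ++ c) :: cs else b :: c :: cs.
Proof.
move=> + + E; have : [::] \notin c :: cs by rewrite -E max_strings_neq0.
case: c E => [|y c] E; first by rewrite inE.
move=> _; elim: b => //= x [|x' b] IHb _ /=; first by rewrite E.
case/andP=> rxx' sb; rewrite -cat1s in IHb *.
have {}IHb := IHb isT sb; rewrite /= in IHb; rewrite IHb.
by case: ifP => _; rewrite /= rxx'.
Qed.

Lemma max_strings_sorted_id (r : rel nat) b :
  b != [::] -> sorted r b -> max_strings r b = [:: b].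
Proof.
elim: b => //= x [|y b] IHb _ //= /andP[rxy sb].
by have /= -> := IHb isT sb; rewrite rxy.
Qed.

(** Converse to the properties of [max_strings] shown with its definition: together they determine
    the factorization. *)
Lemma max_strings_flatten (r : rel nat) bs :
    [::] \notin bs -> all (sorted r) bs ->
    sorted (fun b c => ~~ r (last 0 b) (head 0 c)) bs ->
  max_strings r (flatten bs) = bs.
Proof.
elim: bs => //= b [|c bs] IHbs.
  by rewrite inE eq_sym cats0 andbT => b0 sb _; rewrite max_strings_sorted_id.
rewrite inE negb_or eq_sym => /andP[b0 bs0] /andP[sb sbs] /= /andP[nr sbs'].
by rewrite (max_strings_cat b0 sb (IHbs bs0 sbs sbs')) (negPf nr).
Qed.

(** * Pop-stacked permutations in terms of overlapping runs *)

(* For increasing [b] and [c] this reads min b <= max c. *)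
Definition overlap (b c : seq nat) := head 0 b <= last 0 c.

Lemma sorted_head_le_last b : sorted ltn b -> head 0 b <= last 0 b.
Proof.
case: b => //= x b; elim: b x => //= y b IHb x /andP[lt_xy /IHb].
exact/leq_trans/ltnW.
Qed.

(** Adjacent blocks may merge into one run. A merged run has the minimum of its first block and the
    maximum of its last, so merging only lowers minima and raises maxima, which preserves
    overlaps. *)
Lemma overlap_runs_flatten bs :
    [::] \notin bs -> all (sorted ltn) bs -> sorted overlap bs ->
  sorted overlap (runs (flatten bs)).
Proof.
move=> bs0 sbs obs.
(* The induction must also know that the first run keeps the head of the first block and ends no
   lower than it, so that an overlap with a preceding block carries over. *)
suff: match bs with
  | [::] => true
  | b :: _ => if runs (flatten bs) is c :: _ then
                (head 0 c == head 0 b) && (last 0 b <= last 0 c) else false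
  end && sorted overlap (runs (flatten bs)) by case/andP.
elim: bs bs0 sbs obs => //= b [|c bs] IHbs.
  rewrite inE eq_sym cats0 andbT => b0 sb _.
  by rewrite /runs max_strings_sorted_id // eqxx leqnn.
rewrite inE negb_or eq_sym => /andP[b0 bs0] /andP[sb sbs] /= /andP[obc obs].
have {IHbs} := IHbs bs0 sbs obs; set t := flatten _.
case E: (runs t) => [|c' cs] //= /andP[/andP[/eqP hc lc] ocs].
have [c'0 sc'] : c' != [::] /\ sorted ltn c'.
  split; last by have := max_strings_sorted ltn t; rewrite -/(runs t) E => /andP[].
  have := max_strings_neq0 ltn t.
  by rewrite -/(runs t) E inE negb_or eq_sym => /andP[].
rewrite /runs (max_strings_cat b0 sb E); case: ifP => [lt_bc|_] /=; last first.
  by rewrite eqxx leqnn ocs /overlap (leq_trans obc lc).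
have -> : head 0 (b ++ c') = head 0 b by case: (b) b0.
have -> : last 0 (b ++ c') = last 0 c' by rewrite last_cat; case: (c') c'0.
have le_bc : head 0 b <= head 0 c'.
  exact: leq_trans (sorted_head_le_last sb) (ltnW lt_bc).
rewrite eqxx (leq_trans (ltnW lt_bc) (sorted_head_le_last sc')) /=.
case: cs ocs {E} => //= d cs /andP[od ->]; rewrite andbT.
rewrite /overlap; have -> : head 0 (b ++ c') = head 0 b by case: (b) b0.
exact: leq_trans od.
Qed.

Lemma head_rev (b : seq nat) : head 0 (rev b) = last 0 b.
Proof. by case/lastP: b => // b x; rewrite rev_rcons last_rcons. Qed.

Lemma last_rev (b : seq nat) : last 0 (rev b) = head 0 b.
Proof. by rewrite -{2}(revK b) head_rev. Qed.

Lemma rev_eq_nil (b : seq nat) : (rev b == [::]) = (b == [::]).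
Proof. by rewrite -!nilpE /nilp size_rev. Qed.

Lemma map_rev_neq0 (bs : seq (seq nat)) :
  ([::] \notin map rev bs) = ([::] \notin bs).
Proof.
by congr negb; elim: bs => //= b bs IHb; rewrite !inE IHb eq_sym rev_eq_nil eq_sym.
Qed.

(** Reversed falls are increasing blocks, and maximality of the falls says exactly that adjacent
    ones overlap. *)
Lemma overlap_runs_flip s : sorted overlap (runs (flip s)).
Proof.
apply: overlap_runs_flatten.
- by rewrite map_rev_neq0 max_strings_neq0.
- rewrite all_map; apply: sub_all (max_strings_sorted gtn s) => b /=.
  by rewrite rev_sorted.
rewrite sorted_map; apply: sub_sorted (max_strings_maximal gtn s) => b c /=.
by rewrite -leqNgt /overlap head_rev last_rev.
Qed.

(** Reversed runs are decreasing, and the overlaps make them maximal; hence they are the falls, and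
    [flip] reverses them back. *)
Lemma flip_flatten_rev_runs s :
  sorted overlap (runs s) -> flip (flatten (map rev (runs s))) = s.
Proof.
move=> os; rewrite /flip /falls max_strings_flatten.
- rewrite -map_comp (eq_map (g := id)) ?map_id ?flatten_max_strings //.
  exact: revK.
- by rewrite map_rev_neq0 max_strings_neq0.
- rewrite all_map; apply: sub_all (max_strings_sorted ltn s) => b /=.
  by rewrite rev_sorted.
rewrite sorted_map; apply: sub_sorted os => b c /=.
by rewrite -leqNgt last_rev head_rev.
Qed.

Lemma perm_flatten_map_rev (bs : seq (seq nat)) :
  perm_eq (flatten (map rev bs)) (flatten bs).
Proof. by elim: bs => //= b bs IHb; apply: perm_cat => //; rewrite perm_rev. Qed.

(** * Permutations as rearrangements of [iota 0 n] *)

Lemma perm_one_line n (t : 'S_n) : perm_eq (one_line t) (iota 0 n).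
Proof.
rewrite -val_enum_ord /one_line (map_comp val t); apply: perm_map.
apply: uniq_perm; rewrite ?(map_inj_uniq perm_inj) ?enum_uniq //.
move=> i; rewrite mem_enum; apply/mapP; exists ((t^-1)%g i); last by rewrite permKV.
by rewrite mem_enum.
Qed.

Lemma one_line_inj n : injective (@one_line n).
Proof.
move=> s t; rewrite /one_line => /eq_in_map e.
by apply/permP => i; apply: val_inj; apply: e; rewrite mem_enum.
Qed.

Lemma one_line_surj n s :
  perm_eq s (iota 0 n) -> exists t : 'S_n, one_line t = s.
Proof.
move=> ps; have sz : size s = n by rewrite (perm_size ps) size_iota.
have us : uniq s by rewrite (perm_uniq ps) iota_uniq.
(* The default of [insubd] never occurs, since all entries of [s] are below [n]. *)
pose f (i : 'I_n) : 'I_n := insubd i (nth 0 s i).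
have fE i : val (f i) = nth 0 s i.
  rewrite val_insubd; have : nth 0 s i \in s by rewrite mem_nth ?sz.
  by rewrite (perm_mem ps) mem_iota => /= ->.
have fI : injective f.
  move=> i j /(congr1 val); rewrite !fE => /eqP; rewrite nth_uniq ?sz //.
  by move/eqP/val_inj.
exists (perm fI); rewrite /one_line.
rewrite (eq_map (g := nth 0 s \o val)); last by move=> i; rewrite permE fE.
by rewrite map_comp val_enum_ord -sz -/(mkseq _ _) mkseq_nth.
Qed.

Lemma pop_stackedE n (t : 'S_n) :
  pop_stacked t = sorted overlap (runs (one_line t)).
Proof.
apply/existsP/idP => [[p /eqP->]|ot]; first exact: overlap_runs_flip.
have /one_line_surj[p pE] :
    perm_eq (flatten (map rev (runs (one_line t)))) (iota 0 n).
  apply: perm_trans (perm_flatten_map_rev _) _.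
  by rewrite flatten_max_strings perm_one_line.
by exists p; rewrite pE flip_flatten_rev_runs.
Qed.

(** * Coding permutations by words of run indices *)

(* When [u] codes a permutation, [block u i] is its [i]-th run: the positions in
   [u] are the values of the permutation. *)
Definition block (u : seq nat) (i : nat) : seq nat :=
  [seq v <- iota 0 (size u) | nth 0 u v == i].

(** The first condition says that no run is empty. The subwords [i (i+1)] express the overlap of
    runs [i] and [i+1], and the subwords [(i+1) i] that these two runs do not merge. *)
Definition good_word (k : nat) (u : seq nat) : bool :=
  all (mem u) (iota 0 k) &&
  all (fun i => subseq [:: i; i.+1] u && subseq [:: i.+1; i] u) (iota 0 k.-1).

Lemma mem_block u i v : (v \in block u i) = (v < size u) && (nth 0 u v == i).
Proof. by rewrite mem_filter mem_iota add0n andbC. Qed.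

Lemma block_sorted u i : sorted ltn (block u i).
Proof. exact: sorted_filter ltn_trans _ _ (iota_ltn_sorted _ _). Qed.

Lemma block_eq0 u i : (block u i == [::]) = (i \notin u).
Proof.
apply/eqP/idP => [b0|]; last first.
  case E: (block u i) => [|v b] // /negP[].
  have : v \in block u i by rewrite E mem_head.
  by rewrite mem_block => /andP[lt_v /eqP<-]; apply: mem_nth.
apply/negP => iu; have : index i u \in block u i.
  by rewrite mem_block index_mem iu nth_index ?eqxx.
by rewrite b0.
Qed.

Lemma subseq2P (u : seq nat) i j :
  reflect (exists v1 v2, [/\ v1 < v2, v2 < size u, nth 0 u v1 = i & nth 0 u v2 = j])
          (subseq [:: i; j] u).
Proof.
elim: u => [|x u IHu]; first by right=> [[v1 [v2 []]]].
rewrite /=; case: eqP => [<-|ix].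
  rewrite sub1seq; apply: (iffP idP) => [ju|[v1 [[|v2] [//]]]].
    by exists 0, (index j u).+1; split; rewrite //= ?nth_index // ltnS index_mem.
  by move=> _ lt_v2 _ <-; apply: mem_nth.
apply: (iffP IHu) => [[v1 [v2 [lt_v lt_v2 e1 e2]]]|].
  by exists v1.+1, v2.+1.
case=> [[|v1]] [[|v2]] [//=]; first by move=> _ _ /esym.
by move=> lt_v lt_v2 e1 e2; exists v1, v2.
Qed.

Lemma sorted_ltn_bounds b v :
  sorted ltn b -> v \in b -> head 0 b <= v <= last 0 b.
Proof.
move=> sb; elim: b sb => //= x b IHb; rewrite inE => pb /predU1P[->|vb].
  by rewrite leqnn /=; apply: (@sorted_head_le_last (x :: b)).
have {IHb} := IHb (path_sorted pb) vb.
case: b pb vb => //= y b /andP[lt_xy _] _ /andP[le_yv ->].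
by rewrite (leq_trans (ltnW lt_xy)).
Qed.

(** Some [i] precedes some [j] in [u] iff the first [i] precedes the last [j]; as [i != j], these
    positions differ, so the weak inequality in [overlap] is strict here. *)
Lemma overlap_block u i j : i != j -> i \in u -> j \in u ->
  overlap (block u i) (block u j) = subseq [:: i; j] u.
Proof.
move=> ij iu ju.
have hb : head 0 (block u i) \in block u i.
  move: iu; rewrite -[_ \in _]negbK -block_eq0.
  by case: (block u i) => //= x b; rewrite mem_head.
have lb : last 0 (block u j) \in block u j.
  move: ju; rewrite -[_ \in _]negbK -block_eq0.
  by case: (block u j) => //= x b; rewrite mem_last.
apply/idP/subseq2P => [o|[v1 [v2 [lt_v lt_v2 e1 e2]]]].
  exists (head 0 (block u i)), (last 0 (block u j)).
  move: hb lb; rewrite !mem_block => /andP[_ /eqP e1] /andP[-> /eqP e2]; split=> //.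
  rewrite ltn_neqAle [_ <= _]o andbT; apply: contra ij => /eqP e.
  by rewrite -e1 -e2 e.
have /andP[le1 _] : head 0 (block u i) <= v1 <= last 0 (block u i).
  by apply: sorted_ltn_bounds (block_sorted _ _) _; rewrite mem_block e1 eqxx (ltn_trans lt_v).
have /andP[_ le2] : head 0 (block u j) <= v2 <= last 0 (block u j).
  by apply: sorted_ltn_bounds (block_sorted _ _) _; rewrite mem_block e2 eqxx lt_v2.
exact: leq_trans le1 (leq_trans (ltnW lt_v) le2).
Qed.

Lemma mem_block_seq k u : ([::] \in mkseq (block u) k) = ~~ all (mem u) (iota 0 k).
Proof.
rewrite -has_predC; apply/mapP/hasP => [[i ik /eqP]|[i ik /= iu]].
  by rewrite eq_sym block_eq0; exists i.
by exists i => //; apply/eqP; rewrite eq_sym block_eq0.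
Qed.

Lemma good_wordE k u :
  good_word k u = [&& [::] \notin mkseq (block u) k,
    sorted (fun b c => ~~ (last 0 b < head 0 c)) (mkseq (block u) k)
    & sorted overlap (mkseq (block u) k)].
Proof.
rewrite mem_block_seq negbK /good_word.
case: (boolP (all _ (iota 0 k))) => //= /allP uk.
have ov i : i.+1 < k -> overlap (block u i) (block u i.+1) = subseq [:: i; i.+1] u
   /\ overlap (block u i.+1) (block u i) = subseq [:: i.+1; i] u.
  move=> ik; have iu : i \in u by apply: uk; rewrite mem_iota /= ltnW.
  have Siu : i.+1 \in u by apply: uk; rewrite mem_iota.
  by split; apply: overlap_block => //; rewrite neq_ltn ltnSn ?orbT.
have kE i : (i \in iota 0 k.-1) = (i.+1 < k) by rewrite mem_iota; case: (k).
apply/allP/andP => [H|[/(sortedP [::]) H1 /(sortedP [::]) H2] i].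
  split; apply/(sortedP [::]) => i; rewrite size_mkseq => ik;
    have [o1 o2] := ov i ik; have := H i; rewrite kE ik => /(_ isT) /andP[s1 s2];
    rewrite !nth_mkseq // ?(ltnW ik) //.
    by rewrite -leqNgt -[_ <= _]/(overlap _ _) o2.
  by rewrite o1.
rewrite kE => ik; have [<- <-] := ov i ik; move: (H1 i) (H2 i).
rewrite size_mkseq !nth_mkseq // ?(ltnW ik) // -leqNgt => /(_ ik) h /(_ ik) ->.
exact: h.
Qed.

Lemma runs_flatten_block k u :
  good_word k u -> runs (flatten (mkseq (block u) k)) = mkseq (block u) k.
Proof.
rewrite good_wordE => /and3P[b0 sb _]; apply: max_strings_flatten => //.
by apply/allP => _ /mapP[i _ ->]; apply: block_sorted.
Qed.

Lemma perm_flatten_block k u :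
  all (gtn k) u -> perm_eq (flatten (mkseq (block u) k)) (iota 0 (size u)).
Proof.
(* The bound on the letters becomes a filter on positions, since as a hypothesis on [u] it would not
   pass to smaller [k] in the induction. *)
move=> /allP uk; have -> : iota 0 (size u) = [seq v <- iota 0 (size u) | nth 0 u v < k].
  rewrite -[LHS](filter_predT); apply: eq_in_filter => v.
  rewrite mem_iota add0n => /= lt_v.
  by apply/esym/uk/mem_nth.
elim: k {uk} => [|k IHk].
  by rewrite (eq_filter (a2 := pred0)) ?filter_pred0.
rewrite mkseqS flatten_rcons.
rewrite perm_sym -(perm_filterC (fun v => nth 0 u v < k) [seq _ <- _ | _]).
rewrite -!filter_predI perm_sym; apply: perm_cat.
  apply: perm_trans IHk _; rewrite (eq_filter (a2 := fun v => nth 0 u v < k)) // => v /=.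
  by rewrite ltnS; case: ltngtP.
rewrite /block (eq_filter (a1 := predI _ _) (a2 := fun v => nth 0 u v == k)) // => v /=.
by rewrite ltnS -leqNgt andbC -eqn_leq eq_sym.
Qed.

Lemma block_seq_inj k u u' : all (gtn k) u -> size u = size u' ->
  mkseq (block u) k = mkseq (block u') k -> u = u'.
Proof.
move=> /allP uk sz e; apply: (@eq_from_nth _ 0) => // v lt_v.
have ik : nth 0 u v < k by apply/uk/mem_nth.
have : v \in block u (nth 0 u v) by rewrite mem_block lt_v eqxx.
rewrite -(nth_mkseq [::] (block u) ik) e nth_mkseq // mem_block => /andP[_].
by move/eqP.
Qed.

Lemma find_uniq_flatten (bs : seq (seq nat)) i v :
  uniq (flatten bs) -> v \in nth [::] bs i -> find (fun b => v \in b) bs = i.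
Proof.
elim: bs i => [|b bs IHb] [|i] //=; first by move=> _ ->.
rewrite cat_uniq => /and3P[_ /hasPn nb ub] vi.
rewrite (IHb i) //; case: ifP => // vb.
have /nb/= : v \in flatten bs; last by rewrite vb.
apply/flattenP; exists (nth [::] bs i) => //; apply: mem_nth.
by case: ltnP vi => // le; rewrite nth_default.
Qed.

(** The word [u] sends each value to the index of the block containing it; a strictly increasing
    block is determined by its set of values. *)
Lemma block_seq_surj n bs :
    all (sorted ltn) bs -> perm_eq (flatten bs) (iota 0 n) ->
  exists2 u, size u = n /\ all (gtn (size bs)) u & mkseq (block u) (size bs) = bs.
Proof.
move=> /allP sbs pbs.
have ubs : uniq (flatten bs) by rewrite (perm_uniq pbs) iota_uniq.
have mbs v : (v \in flatten bs) = (v < n) by rewrite (perm_mem pbs) mem_iota.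
pose u := mkseq (fun v => find (fun b => v \in b) bs) n.
have fP v : v < n -> has (fun b => v \in b) bs.
  by rewrite -mbs => /flattenP[b bbs vb]; apply/hasP; exists b.
exists u; first split; rewrite ?size_mkseq //.
  by apply/allP => _ /mapP[v + ->]; rewrite mem_iota /= -has_find => /fP.
apply: (@eq_from_nth _ [::]); rewrite size_mkseq // => i ik.
rewrite nth_mkseq //; apply: irr_sorted_eq ltn_trans ltnn _ _ (block_sorted _ _) _ _.
  exact/sbs/mem_nth.
move=> v; rewrite mem_block size_mkseq; apply/andP/idP => [[vn]|vi].
  by rewrite nth_mkseq // => /eqP<-; apply: nth_find (fP v vn).
have vn : v < n by rewrite -mbs; apply/flattenP; exists (nth [::] bs i); rewrite ?mem_nth.
by rewrite vn nth_mkseq // (find_uniq_flatten ubs vi).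
Qed.

(** The bijection sends [w] to the permutation obtained by concatenating its blocks. For a good word
    these are the runs, so [w] can be recovered. *)
Lemma num_pop_stackedE n k :
  num_pop_stacked n k.+1 =
  #|[set w : n.-tuple 'I_k.+1 | good_word k.+1 (map val w)]|.
Proof.
pose bl (w : n.-tuple 'I_k.+1) := mkseq (block (map val w)) k.+1.
have wk (w : n.-tuple 'I_k.+1) : all (gtn k.+1) (map val w).
  by apply/allP => _ /mapP[i _ ->] /=.
have sz (w : n.-tuple 'I_k.+1) : size (map val w) = n by rewrite size_map size_tuple.
(* The default [1] never occurs: the concatenated blocks rearrange [iota 0 n]. *)
pose f w : 'S_n := odflt 1%g [pick t | one_line t == flatten (bl w)].
have fE w : one_line (f w) = flatten (bl w).
  rewrite /f; case: pickP => [t /eqP //|no].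
  have /one_line_surj[t tE] : perm_eq (flatten (bl w)) (iota 0 n).
    by rewrite -[n in iota _ n](sz w) perm_flatten_block.
  by have := no t; rewrite tE eqxx.
rewrite -(@card_in_imset _ _ f) => [|w w']; last first.
  rewrite !inE => gw gw' /(congr1 (@one_line n)); rewrite !fE => /(congr1 runs).
  rewrite !runs_flatten_block // => /(block_seq_inj (wk w)) e.
  by apply/val_inj/(inj_map val_inj)/e; rewrite !sz.
apply: eq_card => t; rewrite inE pop_stackedE; apply/andP/imsetP => [[ot /eqP rk]|[w]].
  have [u [un uk] uE] : exists2 u, size u = n /\ all (gtn k.+1) u
      & mkseq (block u) k.+1 = runs (one_line t).
    rewrite -rk; apply: block_seq_surj; first exact: max_strings_sorted.
    by rewrite flatten_max_strings perm_one_line.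
  pose w := [tuple of map (@inord k) (tcast un (in_tuple u))].
  have wE : map val w = u.
    rewrite /= val_tcast -map_comp map_id_in // => v /(allP uk) vk /=.
    by rewrite inordK.
  exists w; last by apply: one_line_inj; rewrite fE /bl wE uE flatten_max_strings.
  rewrite inE good_wordE wE uE max_strings_neq0 ot andbT.
  exact: max_strings_maximal.
rewrite inE => gw ->; rewrite fE runs_flatten_block // size_mkseq eqxx; split=> //.
by move: gw; rewrite good_wordE => /and3P[].
Qed.

(** * An automaton recognizing the good words *)

Lemma subseq_map_inj (T1 T2 : eqType) (f : T1 -> T2) (s1 s2 : seq T1) :
  injective f -> subseq (map f s1) (map f s2) = subseq s1 s2.
Proof.
move=> f_inj; elim: s2 s1 => [|y s2 IHs] [|x s1] //=.
by rewrite (inj_eq f_inj) -IHs; case: eqP.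
Qed.

(* The automaton remembers which letters, and which ordered pairs of letters,
   occur as scattered subwords of what it has read. *)
Definition subword_state (k : nat) := ({set 'I_k} * {set 'I_k * 'I_k})%type.

Definition subword_step k (q : subword_state k) (a : 'I_k) : subword_state k :=
  (a |: q.1, q.2 :|: [set p | (p.1 \in q.1) && (p.2 == a)]).

Lemma subword_stepP k (q : subword_state k) (w : seq 'I_k) :
  let q' := foldl (@subword_step k) q w in
  (forall i, (i \in q'.1) = (i \in q.1) || (i \in w)) /\
  (forall i j, ((i, j) \in q'.2) =
     [|| (i, j) \in q.2, (i \in q.1) && (j \in w) | subseq [:: i; j] w]).
Proof.
elim: w q => [|a w IHw] q /=.
  by split=> [i|i j]; rewrite ?in_nil ?orbF ?andbF ?orbF.
have [IH1 IH2] := IHw (subword_step q a); split=> [i|i j].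
  by rewrite IH1 !inE orbCA orbA.
(* This absorbs the case [i == a]: reading [a] then already makes the pair depend only on whether
   [j] occurs in [w]. *)
rewrite IH2 !inE /=; have sj : subseq [:: i; j] w -> j \in w.
  by move/mem_subseq; apply; rewrite !inE eqxx orbT.
have -> : subseq (if i == a then [:: j] else [:: i; j]) w =
    if i == a then j \in w else subseq [:: i; j] w by case: ifP; rewrite ?sub1seq.
move: sj; case: (subseq _ _) => [/(_ isT)->|_];
  by case: (i == a) (j == a) (i \in q.1) (j \in w) (_ \in q.2) => [] [] [] [] [].
Qed.

Definition subword_accept k : pred (subword_state k) := fun q =>
  [forall i, i \in q.1] &&
  [forall i, forall j, (val j == (val i).+1) ==> ((i, j) \in q.2) && ((j, i) \in q.2)].

Lemma subword_acceptP k (w : seq 'I_k) :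
  subword_accept (foldl (@subword_step k) (set0, set0) w) = good_word k (map val w).
Proof.
have [q1 q2] := subword_stepP (set0, set0) w.
rewrite /subword_accept /good_word; congr (_ && _).
  apply/forallP/allP => [H i|H i].
    rewrite mem_iota /= => ik; have := H (Ordinal ik).
    by rewrite q1 inE => iw; apply/mapP; exists (Ordinal ik).
  by have := H (val i); rewrite mem_iota /= ltn_ord q1 inE mem_map //; [apply|apply: val_inj].
have subE i j : ((i, j) \in (foldl (@subword_step k) (set0, set0) w).2) =
    subseq [:: val i; val j] (map val w).
  by rewrite q2 !inE /= -(subseq_map_inj [:: i; j] w val_inj).
have kE i : (i \in iota 0 k.-1) = (i.+1 < k) by rewrite mem_iota; case: (k).
apply/forallP/allP => [H i|H i].
  rewrite kE => ik; have := H (Ordinal (ltnW ik)) => /forallP/(_ (Ordinal ik)).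
  by rewrite /= eqxx !subE.
apply/forallP => j; apply/implyP => /eqP ji; rewrite !subE ji.
have ik : val i \in iota 0 k.-1 by rewrite kE -ji; exact: ltn_ord.
exact: H ik.
Qed.

Theorem theorem6 (k : nat) (hk : (1 <= k)%N) : is_rational (pop_stacked_gf k).
Proof.
case: k hk => // k _.
have [a [b [b0 ab]]] :=
  is_rational_automaton (@subword_step k.+1) (set0, set0) (@subword_accept k.+1).
exists a, b; split=> // n; rewrite -ab; apply: eq_bigr => i _; congr (_ * _)%R.
have cE m : #|[set w : m.-tuple 'I_k.+1 |
    subword_accept (foldl (@subword_step k.+1) (set0, set0) w)]| = num_pop_stacked m k.+1.
  rewrite num_pop_stackedE; apply: eq_card => w.
  by rewrite !inE subword_acceptP.
rewrite cE; case: (n - i)%N => //=.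
(* The constant coefficient is 0 by convention, and the count agrees: there is at least one letter,
   so the empty word misses some letter and is not good. *)
rewrite -cE [X in (X%:R)%R](_ : _ = 0%N) //; apply/eqP; rewrite cards_eq0; apply/eqP/setP => w.
by rewrite !inE tuple0 subword_acceptP.
Qed.
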